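(* Let $(X,Y,A,f,h)$ satisfy the standing assumptions in the context. Let $\alpha_k\in[0,1]$, $k=0,1,2,\dots$, and let $(v_k,y_k,z_k)$, $k=0,1,2,\dots$, be the iterates generated by the generalized mirror descent algorithm for $\min_{x\in X}\{f(Ax)+h(x)\}$ (defined in the context) with step sizes $\alpha_k$. If $\alpha_0=1$, then for all $k=1,2,\dots$ $$\sum_{i=0}^{k-1}\lambda_i^k\bigl(f(Ay_i)+h(y_i)\bigr)-\sum_{i=0}^{k-1}\mu_i^k\,\mathcal{D}_{h^*\circ A^*,\tilde f^*}(v_i,-z_i,\alpha_i)=-f^*(-v_k)-h^*(A^*v_k).$$
   Context: Setting. $X,Y$ are finite-dimensional real vector spaces with duals $X^*,Y^*$ and pairings $\langle\cdot,\cdot\rangle$; $A:X\to Y$ is linear with adjoint $A^*:Y^*\to X^*$; $f:Y\to\mathbb{R}\cup\{\infty\}$ and $h:X\to\mathbb{R}\cup\{\infty\}$ are proper closed convex functions with Fenchel conjugates $f^*:Y^*\to\mathbb{R}\cup\{\infty\}$, $h^*:X^*\to\mathbb{R}\cup\{\infty\}$. $\operatorname{dom}(\partial f)\subseteq Y$ and $\operatorname{dom}(\partial h^* )\subseteq X^*$ are the sets of points at which the respective subdifferential is nonempty. Single-valued oracles are fixed: for each $y\in\operatorname{dom}(\partial f)$, $\partial f(y)\in Y^*$ denotes one fixed chosen element of $\operatorname{argmax}_{v\in Y^*}\{\langle v,y\rangle-f^*(v)\}$ (the subdifferential of $f$ at $y$); for each $u\in\operatorname{dom}(\partial h^* )$,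 $\partial h^*(u)\in X$ denotes one fixed chosen element of $\operatorname{argmax}_{x\in X}\{\langle u,x\rangle-h(x)\}$ (the subdifferential of $h^*$ at $u$). Standing assumption: $-A^*\partial f(y)\in\operatorname{dom}(\partial h^* )$ for all $y\in\operatorname{dom}(\partial f)$, and $A\,\partial h^*(u)\in\operatorname{dom}(\partial f)$ for all $u\in\operatorname{dom}(\partial h^* )$. Generalized Bregman distance: $D_{h^*}(v,u)=h^*(v)-h^*(u)-\langle v-u,\partial h^*(u)\rangle$ for $u\in\operatorname{dom}(\partial h^* )$, $v\in\operatorname{dom}(h^* )$, with the chosen subgradient; $D_{h^*\circ A^*}(v',v):=D_{h^*}(A^*v',A^*v)$. Notation: $\tilde f(y):=f(-y)$ (so $\tilde f^*(v)=f^*(-v)$), and $$\mathcal{D}_{h^*\circ A^*,\tilde f^*}(v,-z,\alpha):=D_{h^*\circ A^*}((1-\alpha)v-\alpha z,v)+f^*(-(1-\alpha)v+\alpha z)-(1-\alpha)f^*(-v)-\alpha f^*(z),$$ with the convention $0\cdot\infty=0$ (relevant only for $i=0$, $\alpha_0=1$). Generalized mirror descent algorithm: given $v_0\in Y^*$ with $A^*v_0\in\operatorname{dom}(\partial h^* )$, for $k=0,1,2,\dots$: $y_k:=\partial h^*(A^*v_k)$, $z_k:=\partial f(Ay_k)$, $v_{k+1}:=(1-\alpha_k)v_k-\alpha_kz_k$, where $\alpha_k\in[0,1]$. The iterates are understood to be well defined, i.e. $A^*v_k\in\operatorname{dom}(\partial h^* )$ for all $k$. Weights: for $k=0,1,2,\dots$,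 $\lambda^{k+1}_k=\alpha_k$, $\mu^{k+1}_k=1$, and $\lambda^{k+1}_i=(1-\alpha_k)\lambda^k_i$, $\mu^{k+1}_i=(1-\alpha_k)\mu^k_i$ for $i=0,\dots,k-1$. *)

(* Defs.v *)
From HB Require Import structures.
From mathcomp Require Import all_boot all_order all_algebra.
From mathcomp Require Import all_classical all_reals all_analysis.

Set Implicit Arguments.
Unset Strict Implicit.
Unset Printing Implicit Defensive.

Import Order.TTheory GRing.Theory Num.Theory.
Import numFieldNormedType.Exports.

Local Open Scope classical_set_scope.
Local Open Scope ring_scope.
Local Open Scope ereal_scope.

(* A finite-dimensional real vector space is a [vectType R], and its dual is
   the space of linear forms ['Hom(V, R^o)]; the pairing <v, x> is [v x].
   Functions into R u {oo} are functions into [\bar R] that are never [-oo]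
   (a part of [proper_fun]). *)

Section ConvexFunctions.
Variables (R : realType) (V : vectType R).
Implicit Types (f : V -> \bar R).

Definition proper_fun f : Prop :=
  (forall x, f x != -oo) /\ (exists x, f x != +oo).

Definition convex_efun f : Prop :=
  forall (x y : V) (t : R), (0 < t < 1)%R ->
    f ((1 - t) *: x + t *: y)%R <= (1 - t)%:E * f x + t%:E * f y.

(* A [vectType] carries no topology: its unique Hausdorff linear topology is
   that of the space of coordinates in any basis. *)
Definition from_coord (r : 'rV[R]_(\dim {:V})) : V :=
  (\sum_(i < \dim {:V}) r ord0 i *: (vbasis {:V})`_i)%R.

Definition closed_efun f : Prop :=
  lower_semicontinuous (fun r : 'rV[R]_(\dim {:V}) => f (from_coord r)).

Definition proper_closed_convex f : Prop :=
  [/\ proper_fun f, closed_efun f & convex_efun f].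

Definition fenchel_conj f (v : 'Hom(V, R^o)) : \bar R :=
  ereal_sup [set (v x : R)%:E - f x | x in [set: V]].

Definition argmax (T : Type) (phi : T -> \bar R) : set T :=
  [set t | forall s, phi s <= phi t].

Definition subdiff f (y : V) : set 'Hom(V, R^o) :=
  argmax (fun v : 'Hom(V, R^o) => (v y : R)%:E - fenchel_conj f v).

(* The subdifferential of the conjugate of [f], as a subset of [V] itself
   rather than of its bidual. *)
Definition subdiff_conj f (u : 'Hom(V, R^o)) : set V :=
  argmax (fun x : V => (u x : R)%:E - f x).

Definition dom_subdiff f : set V := [set y | subdiff f y !=set0].

Definition dom_subdiff_conj f : set 'Hom(V, R^o) :=
  [set u | subdiff_conj f u !=set0].

(* [dfs u] is the chosen subgradient of [fenchel_conj f] at [u]. *)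
Definition bregman_conj f (dfs : 'Hom(V, R^o) -> V) (v u : 'Hom(V, R^o)) :
    \bar R :=
  fenchel_conj f v - fenchel_conj f u - ((v - u)%R (dfs u) : R)%:E.

End ConvexFunctions.

Section MirrorDescent.
Variables (R : realType) (X Y : vectType R).
Variable A : 'Hom(X, Y).

Definition adjoint (v : 'Hom(Y, R^o)) : 'Hom(X, R^o) := (v \o A)%VF.

Variables (f : Y -> \bar R) (h : X -> \bar R).
(* The oracles: only their values on the domains of the respective
   subdifferentials are meaningful. *)
Variables (df : Y -> 'Hom(Y, R^o)) (dhs : 'Hom(X, R^o) -> X).

Definition oracles : Prop :=
  (forall y, dom_subdiff f y -> subdiff f y (df y)) /\
  (forall u, dom_subdiff_conj h u -> subdiff_conj h u (dhs u)).

Definition standing_assumption : Prop :=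
  (forall y, dom_subdiff f y -> dom_subdiff_conj h (- adjoint (df y))%R) /\
  (forall u, dom_subdiff_conj h u -> dom_subdiff f (A (dhs u))).

Definition bregman_conj_adjoint (v' v : 'Hom(Y, R^o)) : \bar R :=
  bregman_conj h dhs (adjoint v') (adjoint v).

(* [mirror_gap v z a] is D_{h^* o A^*, ft^*}(v, -z, a), where ft y := f (- y),
   so that ft^* v = f^* (- v); the sign of [z] is thus built in. The convention
   0 * oo = 0 is that of [mule]. *)
Definition mirror_gap (v z : 'Hom(Y, R^o)) (a : R) : \bar R :=
  bregman_conj_adjoint ((1 - a) *: v - a *: z)%R v
  + fenchel_conj f (- ((1 - a) *: v) + a *: z)%R
  - (1 - a)%:E * fenchel_conj f (- v)%R
  - a%:E * fenchel_conj f z.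

Definition mirror_descent_iterates (alpha : nat -> R)
    (v : nat -> 'Hom(Y, R^o)) (y : nat -> X) (z : nat -> 'Hom(Y, R^o)) : Prop :=
  forall k : nat,
    [/\ dom_subdiff_conj h (adjoint (v k)),
        y k = dhs (adjoint (v k)),
        z k = df (A (y k)) &
        v k.+1 = ((1 - alpha k) *: v k - alpha k *: z k)%R].

End MirrorDescent.

(* [lambda_weight alpha k i] and [mu_weight alpha k i] are lambda^k_i and
   mu^k_i for i < k; they are 0 for i >= k. *)
Section Weights.
Variables (R : realType) (alpha : nat -> R).

Fixpoint lambda_weight (k i : nat) : R :=
  if k is k'.+1 then
    if i == k' then alpha k' else ((1 - alpha k') * lambda_weight k' i)%R
  else 0%R.

Fixpoint mu_weight (k i : nat) : R :=
  if k is k'.+1 then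
    if i == k' then 1%R else ((1 - alpha k') * mu_weight k' i)%R
  else 0%R.

End Weights.

(* Main.v *)
(* Fenchel's equality holds at each oracle call: [h (y_k) = <A^* v_k, y_k> -
   h^* (A^* v_k)] because [y_k] attains the supremum defining [h^*], and
   [f (A y_k) = <z_k, A y_k> - f^* (z_k)] because [f] is its own biconjugate.
   Substituting both, one step of the algorithm contributes
     alpha_k (f (A y_k) + h (y_k)) - D_k = (1 - alpha_k) c_k - c_(k+1),
   where [c_k = f^* (- v_k) + h^* (A^* v_k)], and the weights make this
   telescope; [alpha_0 = 1] cancels the possibly infinite [c_0] and makes every
   later [c_k] finite. Biconjugation is obtained by projecting a point
   [(y, r)], [r < f y], onto the epigraph in coordinates. *)

Require Import Defs.
From HB Require Import structures.
From mathcomp Require Import all_boot all_order all_algebra.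
From mathcomp Require Import all_classical all_reals all_analysis.
From mathcomp Require Import ring lra.

Set Implicit Arguments.
Unset Strict Implicit.
Unset Printing Implicit Defensive.

Import Order.TTheory GRing.Theory Num.Theory.
Import numFieldNormedType.Exports.

Local Open Scope classical_set_scope.
Local Open Scope ring_scope.
Local Open Scope ereal_scope.

(** * Epigraphs of lower semicontinuous functions *)

Lemma closed_epigraph (T : topologicalType) (R : realType) (g : T -> \bar R) :
  lower_semicontinuous g -> closed [set p : T * R | g p.1 <= p.2%:E].
Proof.
move=> lscg; rewrite -openC openE => -[x s] /= /negP; rewrite -ltNge => sgx.
(* A level [c] strictly between [s] and [g x]: near [x] the function exceeds [c], so this
   neighbourhood times the half-line below [c] misses the epigraph. *)
have [c sc cgx] : exists2 c : R, (s < c)%R & c%:E < g x.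
  case: (g x) sgx => [r| |//]; last by move=> _; exists (s + 1)%R; rewrite ?ltry ?ltrDl.
  by rewrite lte_fin => /midf_lt[s_lt lt_r]; exists ((s + r) / 2)%R.
have [U Ux Ug] := lscg x c cgx.
exists (U, [set t | (t < c)%R]) => /=.
  by split=> //; exact: lt_nbhsl.
move=> [x' s'] /= [/Ug cg' s'c]; apply/negP; rewrite -ltNge.
by rewrite (lt_trans _ cg')// lte_fin.
Qed.

(** * Euclidean projection onto closed convex sets *)

Section EuclideanProjection.
Variables (R : realType) (n : nat).
Implicit Types w x y : 'rV[R]_n.
Local Notation E := ('rV[R]_n * R^o)%type.
Implicit Types (p q u : E) (C : set E).
Local Open Scope ring_scope.

Definition row_dot w x : R := \sum_i w ord0 i * x ord0 i.

Lemma row_dotC w x : row_dot w x = row_dot x w.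
Proof. by apply: eq_bigr => i _; rewrite mulrC. Qed.

Lemma row_dotDl w w' x : row_dot (w + w') x = row_dot w x + row_dot w' x.
Proof.
by rewrite /row_dot -big_split/=; apply: eq_bigr => i _; rewrite mxE mulrDl.
Qed.

Lemma row_dotZl a w x : row_dot (a *: w) x = a * row_dot w x.
Proof.
by rewrite /row_dot mulr_sumr; apply: eq_bigr => i _; rewrite mxE mulrA.
Qed.

Lemma row_dotBr w x y : row_dot w (x - y) = row_dot w x - row_dot w y.
Proof. by rewrite row_dotC row_dotDl -scaleN1r row_dotZl mulN1r !(row_dotC w). Qed.

(** The Euclidean inner product of R^n x R, needed for angles: the norm carried by the product type
    is a maximum norm. *)
Definition dotp p q : R := row_dot p.1 q.1 + p.2 * q.2.

Lemma dotpC p q : dotp p q = dotp q p.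
Proof. by rewrite /dotp row_dotC mulrC. Qed.

Lemma dotpDl p q u : dotp (p + q) u = dotp p u + dotp q u.
Proof. by rewrite /dotp row_dotDl mulrDl addrACA. Qed.

Lemma dotpZl a p u : dotp (a *: p) u = a * dotp p u.
Proof. by rewrite /dotp row_dotZl mulrDr mulrA. Qed.

Lemma dotpDr p q u : dotp u (p + q) = dotp u p + dotp u q.
Proof. by rewrite dotpC dotpDl !(dotpC u). Qed.

Lemma dotpZr a p u : dotp u (a *: p) = a * dotp u p.
Proof. by rewrite dotpC dotpZl (dotpC u). Qed.

Lemma dotpp_coord_le p :
  (forall i, p.1 ord0 i ^+ 2 <= dotp p p) /\ p.2 ^+ 2 <= dotp p p.
Proof.
have sq0 (x : R) : 0 <= x * x by rewrite -expr2 sqr_ge0.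
rewrite /dotp /row_dot; split=> [i|]; last by rewrite expr2 lerDr sumr_ge0.
by rewrite (bigD1 i)//= expr2 -addrA lerDl addr_ge0// sumr_ge0.
Qed.

Lemma dotpp_ge0 p : 0 <= dotp p p.
Proof. by rewrite (le_trans _ (dotpp_coord_le p).2)// sqr_ge0. Qed.

Lemma dotpp_eq0 p : dotp p p = 0 -> p = 0.
Proof.
have [le1 le2] := dotpp_coord_le p => p0; rewrite p0 in le1 le2.
have sq0 (x : R) : x ^+ 2 <= 0 -> x = 0.
  by move=> x0; apply/eqP; rewrite -sqrf_eq0 eq_le x0 sqr_ge0.
case: p {p0} le1 le2 => p1 p2 /= le1 /sq0 ->; congr pair.
by apply/rowP => i; rewrite (sq0 _ (le1 i)) mxE.
Qed.

Lemma continuous_dist q : continuous (fun p : E => dotp (q - p) (q - p)).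
Proof.
have sqB (c : R) (u : E -> R) :
    continuous u -> continuous (fun p => (c - u p) * (c - u p)).
  move=> cu p; have cB : c - u x @[x --> p] --> c - u p.
    by apply: cvgB; [exact: cvg_cst|exact: cu].
  exact: cvgM.
have -> : (fun p => dotp (q - p) (q - p)) = (fun p =>
    \sum_i (q.1 ord0 i - p.1 ord0 i) * (q.1 ord0 i - p.1 ord0 i)
    + (q.2 - p.2) * (q.2 - p.2)).
  apply/funext => p; rewrite /dotp /row_dot; congr (_ + _).
  by apply: eq_bigr => i _; rewrite !mxE.
move=> p; apply: cvgD; last by apply: (sqB q.2 snd) => x; exact: cvg_snd.
apply: continuous_big; first exact: add_continuous.
move=> i _; apply: (sqB (q.1 ord0 i) (fun p => p.1 ord0 i)) => u.
apply: (@continuous_comp _ _ _ fst (fun M : 'rV[R]_n => M ord0 i)).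
  exact: cvg_fst.
exact: coord_continuous.
Qed.

(** The distance to [q] attains its minimum on the compact part of [C] lying in a box that contains
    every point at least as close to [q] as a fixed [c] in [C]. *)
Lemma nearest_point C q : closed C -> C !=set0 ->
  exists2 p, C p & forall u, C u -> dotp (q - p) (q - p) <= dotp (q - u) (q - u).
Proof.
move=> Ccl [c Cc].
(* The half-width [M] avoids a square root: since [M >= 1], a square at most [d c] is at most
   [M ^+ 2]. *)
set d := fun p => dotp (q - p) (q - p); pose M := d c + 1.
have M1 : 1 <= M by rewrite lerDr dotpp_ge0.
pose I (a : R) := `[(a - M), (a + M)]%classic : set R.
pose B : set E :=
    [set v : 'rV[R]_n | forall i, I (q.1 ord0 i) (v ord0 i)] `*` I q.2.
have cB : compact B.
  apply: compact_setX; last exact: segment_compact.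
  apply: (@rV_compact R n (fun i => I (q.1 ord0 i))) => i.
  exact: segment_compact.
have inI (a x : R) : (a - x) ^+ 2 <= d c -> I a x.
  move=> ax; rewrite /I /= in_itv/=; apply/andP; split; rewrite /M in M1 *; nra.
have inB p : d p <= d c -> B p.
  move=> pc; have [le1 le2] := dotpp_coord_le (q - p).
  split=> [i|]; apply: inI; last exact: le_trans le2 _.
  by have := le_trans (le1 i) pc; rewrite !mxE.
have cCB : compact (C `&` B) by rewrite setIC; exact: compact_closedI.
have [||p] := compact_EVT_min _ cCB (f := d).
- by exists c; split=> //; exact: inB.
- by apply: continuous_subspaceT => x; exact: continuous_dist.
rewrite inE => -[Cp Bp] pmin; exists p => // u Cu.
have [uc|/ltW cu] := leP (d u) (d c).
  by apply: pmin; rewrite inE; split => //; exact: inB.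
apply: le_trans cu; apply: pmin; rewrite inE; split=> //; exact: inB.
Qed.

(** First-order optimality: moving from [p] towards [u] by a fraction [t] cannot reduce the distance
    to [q], and the linear term dominates for small [t]. *)
Lemma nearest_point_obtuse C q p :
  (forall u v (t : R), C u -> C v -> 0 < t < 1 -> C (u + t *: (v - u))) ->
  C p -> (forall u, C u -> dotp (q - p) (q - p) <= dotp (q - u) (q - u)) ->
  forall u, C u -> dotp (q - p) (u - p) <= 0.
Proof.
move=> Ccvx Cp pmin u Cu; set a := q - p; set b := u - p.
have le_t t : 0 < t < 1 -> 2 * dotp a b <= t * dotp b b.
  move=> t01; have /pmin := Ccvx p u t Cp Cu t01.
  have -> : q - (p + t *: (u - p)) = a + (- t) *: b by rewrite opprD addrA scaleNr.
  rewrite -/a -/b; move: (a) (b) => {}a {}b.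
  rewrite dotpDl !dotpDr !dotpZl !dotpZr (dotpC b a).
  by case/andP: t01 => t0 _; nra.
rewrite leNgt; apply/negP => ab0.
(* This [t] satisfies [t * dotp b b <= dotp a b] and [t <= 1]; halving it gives a step strictly
   inside the unit interval that contradicts [le_t]. *)
pose t := dotp a b / (dotp a b + dotp b b).
have b0 := dotpp_ge0 b.
have t01 : 0 < t / 2 < 1.
  have t1 : t <= 1 by rewrite ler_pdivrMr ?mul1r ?lerDl// ltr_pwDl.
  have : 0 < t by rewrite divr_gt0// ltr_pwDl.
  lra.
have := le_t _ t01.
have : t * dotp b b <= dotp a b.
  rewrite mulrAC ler_pdivrMr; last by rewrite ltr_pwDl.
  by rewrite ler_pM2l// lerDr ltW.
lra.
Qed.

End EuclideanProjection.

(** * Separation from an epigraph and affine minorants *)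

Section EpigraphSeparation.
Variables (R : realType) (n : nat).
Implicit Types w x y : 'rV[R]_n.

Variable g : 'rV[R]_n -> \bar R.
Hypothesis g_ninfty : forall x, g x != -oo.
Hypothesis g_finite : exists x, g x != +oo.
Hypothesis g_lsc : lower_semicontinuous g.
Hypothesis g_convex : forall x y (s s' t : R), (0 < t < 1)%R ->
  g x <= s%:E -> g y <= s'%:E ->
  g (x + t *: (y - x))%R <= (s + t * (s' - s))%:E.

Lemma epigraph_separation y r : r%:E < g y -> exists w (e m : R),
  [/\ (0 <= e)%R, (m < row_dot w y - e * r)%R &
   forall x s, g x <= s%:E -> (row_dot w x - e * s <= m)%R].
Proof.
move=> ry.
pose C := [set p : 'rV[R]_n * R^o | g p.1 <= p.2%:E].
have C0 : C !=set0.
  have [x gx] := g_finite; exists (x, fine (g x)).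
  by rewrite /C /= fineK// fin_numE g_ninfty.
have Ccl : closed C by exact: (@closed_epigraph _ R g).
have [p Cp pmin] := nearest_point (y, r) Ccl C0.
have Ccvx u v t : C u -> C v -> (0 < t < 1)%R -> C (u + t *: (v - u))%R.
  by move=> Cu Cv t01; exact: g_convex.
have := nearest_point_obtuse Ccvx Cp pmin.
have : (0 < dotp ((y, r) - p) ((y, r) - p))%R.
  rewrite lt0r dotpp_ge0 andbT; apply/negP => /eqP /dotpp_eq0 /eqP.
  by rewrite subr_eq0 => /eqP qp; move: Cp; rewrite -qp /C /= leNgt ry.
case: p Cp {pmin} => p t /= Cp.
rewrite /dotp /=.
set w := (y - p)%R => pos le0.
(* The normal is [(y, r)] minus its projection [(p, t)], and [m] is the value at the projection.
   Raising the projection by 1 stays in the epigraph, which forces [0 <= e]. *)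
exists w, (t - r)%R, (row_dot w p - (t - r) * t)%R; split.
- have Cp1 : C (p, t + 1)%R by rewrite /C/= (le_trans Cp)// lee_fin lerDl.
  by have /= := le0 _ Cp1; rewrite row_dotBr subrr; lra.
- by move: pos; rewrite {2}/w row_dotBr; lra.
- move=> x s xs; have /= := le0 (x, s) xs; rewrite row_dotBr; lra.
Qed.

(* If the hyperplane separating [(y, r)] from the epigraph is vertical
   ([e = 0]), tilting any given minorant along it lifts its value at [y]. *)
Lemma affine_minorant y r : r%:E < g y ->
  exists w (c : R), (forall x, (row_dot w x - c)%:E <= g x) /\ (r < row_dot w y - c)%R.
Proof.
(* Dividing by [e > 0] turns the hyperplane into the graph of an affine minorant. *)
have nonvertical (x : 'rV[R]_n) (a e m : R) w : (0 < e)%R ->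
    (m < row_dot w x - e * a)%R ->
    (forall x s, g x <= s%:E -> (row_dot w x - e * s <= m)%R) ->
  exists w (c : R), (forall x, (row_dot w x - c)%:E <= g x) /\ (a < row_dot w x - c)%R.
  move=> e0 mx minor; exists (e^-1 *: w)%R, (e^-1 * m)%R; split.
    move=> u; case gu : (g u) (g_ninfty u) => [s| |] // _; last by rewrite leey.
    have /minor : g u <= s%:E by rewrite gu.
    by rewrite lee_fin row_dotZl -mulrBr ler_pdivrMl//; lra.
  by rewrite row_dotZl -mulrBr ltr_pdivlMl//; lra.
have [w0 [c0 minor0]] : exists w (c : R), forall x, (row_dot w x - c)%:E <= g x.
  have [x] := g_finite; case gx : (g x) (g_ninfty x) => [s| |] // _ _.
  (* Separating a point directly below the finite value [g x] excludes [e = 0], because [(x, g x)]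
     lies on the other side. *)
  have [|w [e [m [e0 mx minor]]]] := @epigraph_separation x (s - 1)%R.
    by rewrite gx lte_fin ltrBlDr ltrDl.
  have [|w' [c [? _]]] := nonvertical x (s - 1)%R e m w _ mx minor; last by exists w', c.
  have /minor : g x <= s%:E by rewrite gx.
  by lra.
move=> ry; have [w [e [m [e0 my minor]]]] := epigraph_separation ry.
have [epos|ele0] := ltP 0%R e.
  exact: (nonvertical _ _ _ _ _ epos my minor).
have e_eq0 : e = 0%R by apply/eqP; rewrite eq_le e0 ele0.
rewrite e_eq0 mul0r subr0 in my; pose d := (row_dot w y - m)%R.
have d0 : (0 < d)%R by rewrite /d; lra.
(* With this slope the gain [k * d] at [y] exceeds the deficit of the first minorant by at least
   1. *)
pose k := ((`|r - (row_dot w0 y - c0)| + 1) / d)%R.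
have k0 : (0 <= k)%R by apply: divr_ge0; [exact: addr_ge0|exact: ltW].
exists (w0 + k *: w)%R, (c0 + k * m)%R; split=> [x|].
  have := minor0 x; case gx : (g x) (g_ninfty x) => [s| |] // _ gs; last by rewrite leey.
  have /minor : g x <= s%:E by rewrite gx.
  rewrite e_eq0 mul0r subr0 => wm; move: gs; rewrite !lee_fin row_dotDl row_dotZl.
  by have := ler_wpM2l k0 wm; lra.
rewrite row_dotDl row_dotZl.
have -> : (row_dot w0 y + k * row_dot w y - (c0 + k * m) = row_dot w0 y - c0 + k * d)%R.
  by rewrite /d; ring.
rewrite /k divfK ?gt_eqF//.
by have := ler_norm (r - (row_dot w0 y - c0)); lra.
Qed.

End EpigraphSeparation.

(** * Affine minorants without coordinates *)

Section FenchelMoreau.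
Variables (R : realType) (V : vectType R) (f : V -> \bar R).
Hypothesis hf : proper_closed_convex f.

Let form (w : 'rV[R]_(\dim {:V})) : 'Hom(V, R^o) :=
  (\sum_i w ord0 i *: linfun (coord (vbasis {:V}) i : V -> R^o))%R.

Let to_coord (x : V) : 'rV[R]_(\dim {:V}) := (\row_i coord (vbasis {:V}) i x)%R.

Let to_coordK x : from_coord (to_coord x) = x.
Proof.
rewrite /from_coord; under eq_bigr do rewrite mxE.
by rewrite -coord_vbasis ?memvf.
Qed.

Let formE w x : form w x = row_dot w (to_coord x).
Proof.
rewrite /form /row_dot sum_lfunE; apply: eq_bigr => i _.
by rewrite scale_lfunE lfunE mxE.
Qed.

Let from_coord_segment x y t :
  (from_coord (x + t *: (y - x)) =
   (1 - t) *: from_coord x + t *: from_coord y :> V)%R.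
Proof.
rewrite /from_coord !scaler_sumr -big_split/=; apply: eq_bigr => i _.
by rewrite !mxE !scalerA -scalerDl; congr (_ *: _)%R; ring.
Qed.

(** The hard half of biconjugation: a minorant with slope [v] and offset [c] says that the conjugate
    at [v] is at most [c], so the biconjugate at [y] exceeds [r]. *)
Lemma affine_minorant_form y r : r%:E < f y ->
  exists v : 'Hom(V, R^o), exists c : R,
    (forall x, ((v x : R) - c)%:E <= f x) /\ (r < (v y : R) - c)%R.
Proof.
move=> ry; have [[f_ninfty [x0 fx0]] f_closed f_convex] := hf.
have [|||||w [c [minor yc]]] :=
    @affine_minorant R _ (fun r => f (from_coord r)) _ _ _ _ (to_coord y) r.
- by move=> x; exact: f_ninfty.
- by exists (to_coord x0); rewrite to_coordK.
- exact: f_closed.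
- move=> x x' s s' t t01 xs xs'; rewrite from_coord_segment.
  apply: (le_trans (f_convex _ _ _ t01)); case/andP: t01 => t0 t1.
  have -> : (s + t * (s' - s) = (1 - t) * s + t * s')%R by ring.
  by rewrite [leRHS]EFinD !EFinM leeD// lee_wpmul2l// lee_fin ?subr_ge0 ltW.
- by rewrite to_coordK.
exists (form w), c; split; last by rewrite formE.
by move=> x; rewrite formE -{2}(to_coordK x).
Qed.

End FenchelMoreau.

(** * Fenchel conjugates and the equality case of Fenchel-Young *)

Section FenchelConjugate.
Variables (R : realType) (V : vectType R).
Implicit Types (f : V -> \bar R) (u v w : 'Hom(V, R^o)).

Lemma fenchel_young f v x : (v x : R)%:E - f x <= fenchel_conj f v.
Proof. by apply: ereal_sup_ubound; exists x. Qed.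

Lemma fenchel_conj_le f v c :
  (forall x, (v x : R)%:E - f x <= c) -> fenchel_conj f v <= c.
Proof. by move=> vc; apply: ge_ereal_sup => _ [x _ <-]. Qed.

Lemma proper_fun_point f : proper_fun f -> exists x (a : R), f x = a%:E.
Proof.
by case=> f_ninfty [x]; case fx : (f x) (f_ninfty x) => [a| |] // _ _; exists x, a.
Qed.

Lemma fenchel_conj_ninfty f v : proper_fun f -> fenchel_conj f v != -oo.
Proof.
move=> /proper_fun_point[x [a fx]]; rewrite gt_eqF//.
by apply: lt_le_trans (fenchel_young f v x); rewrite fx -EFinB ltNyr.
Qed.

Lemma fenchel_conj_fin f v (c : R) : proper_fun f ->
  fenchel_conj f v <= c%:E -> exists b : R, fenchel_conj f v = b%:E.
Proof.
move=> /fenchel_conj_ninfty - /(_ v).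
by case: fenchel_conj => [b| |] // _ _; exists b.
Qed.

(** The weighted sum of the two Fenchel-Young inequalities at each [x]. The endpoints of [t] are
    included because step sizes may be 0 or 1. *)
Lemma fenchel_conj_convex f u w (a b t : R) : proper_fun f -> (0 <= t <= 1)%R ->
  fenchel_conj f u = a%:E -> fenchel_conj f w = b%:E ->
  fenchel_conj f ((1 - t) *: u + t *: w)%R <= ((1 - t) * a + t * b)%:E.
Proof.
move=> [f_ninfty _] /andP[t0 t1] fu fw; apply: fenchel_conj_le => x.
have := fenchel_young f u x; have := fenchel_young f w x; rewrite fu fw.
case: (f x) (f_ninfty x) => [s| |] //= _; last by move=> _ _; rewrite addeNy leNye.
rewrite -!EFinB !lee_fin add_lfunE !scale_lfunE /= => wb ua.
rewrite -[X in (X + _ - _)%R]/((1 - t) * u x)%R -[X in (_ + X - _)%R]/(t * w x)%R.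
have := ler_wpM2l t0 wb; have t1' : (0 <= 1 - t)%R by rewrite subr_ge0.
by have := ler_wpM2l t1' ua; lra.
Qed.

(** A maximiser attains the supremum defining the conjugate; comparison with a point where [f] is
    finite makes [f x] finite. *)
Lemma subdiff_conj_fenchel_eq f u x : proper_fun f -> subdiff_conj f u x ->
  exists a : R, f x = a%:E /\ fenchel_conj f u = ((u x : R) - a)%:E.
Proof.
move=> pf ux; have [x0 [b fx0]] := proper_fun_point pf; have [f_ninfty _] := pf.
have := ux x0; rewrite fx0.
case fx : (f x) (f_ninfty x) => [a| |] // _ _.
exists a; split=> //; apply/eqP; rewrite eq_le EFinB -fx fenchel_young andbT.
exact: fenchel_conj_le.
Qed.

Lemma subdiff_fenchel_eq f y v : proper_closed_convex f -> subdiff f y v ->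
  exists b : R, fenchel_conj f v = b%:E /\ f y = ((v y : R) - b)%:E.
Proof.
move=> hf yv; have [pf _ _] := hf; have [f_ninfty _] := pf.
(* The maximal value is at least the biconjugate at [y], hence exceeds every real below [f y]. One
   such real already rules out an infinite conjugate at [v]. *)
have minor r : r%:E < f y -> r%:E < (v y : R)%:E - fenchel_conj f v.
  move=> /(affine_minorant_form hf)[w [c [wf rw]]].
  have wc : fenchel_conj f w <= c%:E.
    apply: fenchel_conj_le => x.
    have := wf x; case: (f x) (f_ninfty x) => [s| |] // _.
      by rewrite -EFinB !lee_fin; lra.
    by move=> _; rewrite addeNy leNye.
  apply: lt_le_trans (yv w); apply: lt_le_trans (leeB (lexx _) wc).
  by rewrite -EFinB lte_fin.
have [r ry] : exists r, r%:E < f y.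
  case: (f y) (f_ninfty y) => [s| |] // _; last by exists 0%R; rewrite ltry.
  by exists (s - 1)%R; rewrite lte_fin ltrBlDr ltrDl.
have := minor r ry; have := fenchel_conj_ninfty v pf; have := fenchel_young f v y.
move: minor; case fv : fenchel_conj => [b| |] // minor young _ _.
exists b; split=> //; apply/eqP; rewrite eq_le; apply/andP; split.
  by rewrite leNgt; apply/negP => /minor; rewrite -EFinB ltxx.
by move: young; case: (f y) (f_ninfty y) => [s| |] // _;
  rewrite -?EFinB ?lee_fin ?leey//; lra.
Qed.

End FenchelConjugate.

(** * Telescoping of the weighted sums over the reals *)

Section WeightedSums.
Variables (R : realType) (alpha phi gap : nat -> R).
Local Open Scope ring_scope.

Lemma weighted_sum_recr k :
  \sum_(i < k.+1) lambda_weight alpha k.+1 i * phi i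
    - \sum_(i < k.+1) mu_weight alpha k.+1 i * gap i
  = (1 - alpha k) * (\sum_(i < k) lambda_weight alpha k i * phi i
                       - \sum_(i < k) mu_weight alpha k i * gap i)
    + (alpha k * phi k - gap k).
Proof.
rewrite !big_ord_recr /= eqxx mul1r mulrBr !mulr_sumr.
under eq_bigr => i _ do rewrite ltn_eqF ?ltn_ord// -mulrA.
under [X in _ - (X + _)]eq_bigr => i _ do rewrite ltn_eqF ?ltn_ord// -mulrA.
by ring.
Qed.

Lemma weighted_sum_telescope (c : nat -> R) : alpha 0%N = 1 ->
  (forall k, alpha k * phi k - gap k = (1 - alpha k) * c k - c k.+1) ->
  forall k, (0 < k)%N ->
  \sum_(i < k) lambda_weight alpha k i * phi i
    - \sum_(i < k) mu_weight alpha k i * gap i = - c k.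
Proof.
move=> alpha0 step; elim=> // -[_ _|k IHk _]; rewrite weighted_sum_recr step.
  by rewrite alpha0; ring.
by rewrite IHk//; ring.
Qed.

End WeightedSums.

(** * Finiteness and the one-step identity along the iterates *)

Section MirrorDescentIterates.
Variables (R : realType) (X Y : vectType R) (A : 'Hom(X, Y)).
Variables (f : Y -> \bar R) (h : X -> \bar R).
Variables (df : Y -> 'Hom(Y, R^o)) (dhs : 'Hom(X, R^o) -> X).
Hypotheses (hf : proper_closed_convex f) (hh : proper_closed_convex h).
Hypothesis horacles : oracles f h df dhs.
Hypothesis hstanding : standing_assumption A f h df dhs.
Variable alpha : nat -> R.
Hypothesis halpha : forall k : nat, (0 <= alpha k <= 1)%R.
Variables (v : nat -> 'Hom(Y, R^o)) (y : nat -> X) (z : nat -> 'Hom(Y, R^o)).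
Hypothesis hiter : mirror_descent_iterates A h df dhs alpha v y z.
Hypothesis halpha0 : alpha 0%N = 1%R.

Lemma iterate_h_fenchel_eq k : exists a : R, h (y k) = a%:E /\
  fenchel_conj h (adjoint A (v k)) = ((v k (A (y k)) : R) - a)%:E.
Proof.
have [ph _ _] := hh; have [vk -> _ _] := hiter k.
have [a [ha conja]] := subdiff_conj_fenchel_eq ph (horacles.2 _ vk).
by exists a; split=> //; rewrite conja comp_lfunE.
Qed.

Lemma iterate_f_fenchel_eq k : exists b : R, fenchel_conj f (z k) = b%:E /\
  f (A (y k)) = ((z k (A (y k)) : R) - b)%:E.
Proof.
have [vk yk -> _] := hiter k.
apply: subdiff_fenchel_eq => //; apply: horacles.1; rewrite yk.
exact: hstanding.2.
Qed.

Lemma iterate_opp k :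
  (- v k.+1 = - ((1 - alpha k) *: v k) + alpha k *: z k)%R.
Proof. by have [_ _ _ ->] := hiter k; rewrite opprB addrC. Qed.

(** The index starts at 1 since the conjugate may be infinite at [- v 0]. As [alpha 0 = 1], [- v 1]
    is [z 0]; each later [- v k.+1] is a convex combination of [- v k] and [z k], where the
    conjugate is finite. *)
Lemma iterate_conj_fin k : exists F : R, fenchel_conj f (- v k.+1)%R = F%:E.
Proof.
have [pf _ _] := hf.
elim: k => [|k [F FE]].
  rewrite iterate_opp halpha0 subrr scale0r oppr0 add0r scale1r.
  by have [b [-> _]] := iterate_f_fenchel_eq 0; exists b.
have [b [bE _]] := iterate_f_fenchel_eq k.+1.
have := fenchel_conj_convex pf (halpha k.+1) FE bE.
by rewrite (iterate_opp k.+1) -scalerN => /(fenchel_conj_fin pf).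
Qed.

Let phi k := fine (f (A (y k)) + h (y k)).
Let gap k := fine (mirror_gap A f h dhs (v k) (z k) (alpha k)).
(** At [k = 0] the first [fine] may replace [+oo] by 0, which is harmless: [dual 0] only occurs
    multiplied by [1 - alpha 0 = 0]. *)
Let dual k : R :=
  (fine (fenchel_conj f (- v k)%R) + fine (fenchel_conj h (adjoint A (v k))))%R.

Lemma iterate_step k :
  [/\ f (A (y k)) + h (y k) = (phi k)%:E,
      mirror_gap A f h dhs (v k) (z k) (alpha k) = (gap k)%:E &
      (alpha k * phi k - gap k = (1 - alpha k) * dual k - dual k.+1)%R].
Proof.
have [a [hy hv]] := iterate_h_fenchel_eq k.
have [a' [hy' hv']] := iterate_h_fenchel_eq k.+1.
have [b [fz fy]] := iterate_f_fenchel_eq k.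
have [F' FE'] := iterate_conj_fin k.
have [_ yk _ vk1] := hiter k.
have F0 : (1 - alpha k)%:E * fenchel_conj f (- v k)%R =
    ((1 - alpha k) * fine (fenchel_conj f (- v k)%R))%:E.
  by case: (k) => [|j]; [rewrite halpha0 subrr mul0e mul0r
                        |have [F ->] := iterate_conj_fin j; rewrite -EFinM].
(* The linear term of the Bregman distance: it cancels the pairings that the two Fenchel equalities
   bring into [alpha k * phi k]. *)
have pairing : (adjoint A (v k.+1) - adjoint A (v k))%R (y k) =
    (- (alpha k * ((z k (A (y k)) : R) + v k (A (y k)))))%R :> R.
  rewrite add_lfunE opp_lfunE !comp_lfunE vk1 add_lfunE opp_lfunE !scale_lfunE.
  rewrite -![_ *: _]/(_ * _)%R.
  by ring.
have phiE : f (A (y k)) + h (y k) = (phi k)%:E by rewrite /phi hy fy -EFinD.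
have gapE : mirror_gap A f h dhs (v k) (z k) (alpha k) = (gap k)%:E.
  rewrite /gap /mirror_gap /bregman_conj_adjoint /bregman_conj -iterate_opp.
  by rewrite -vk1 FE' F0 fz hv hv'.
split=> //; rewrite /phi /gap /mirror_gap /bregman_conj_adjoint /bregman_conj.
rewrite -iterate_opp -vk1 -yk pairing F0 fz hy fy hv hv' /dual hv hv' FE' /=.
by ring.
Qed.

End MirrorDescentIterates.

Theorem proposition4 (R : realType) (X Y : vectType R) (A : 'Hom(X, Y))
    (f : Y -> \bar R) (h : X -> \bar R)
    (df : Y -> 'Hom(Y, R^o)) (dhs : 'Hom(X, R^o) -> X)
    (hf : proper_closed_convex f) (hh : proper_closed_convex h)
    (horacles : oracles f h df dhs)
    (hstanding : standing_assumption A f h df dhs)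
    (alpha : nat -> R) (halpha : forall k : nat, (0 <= alpha k <= 1)%R)
    (v : nat -> 'Hom(Y, R^o)) (y : nat -> X) (z : nat -> 'Hom(Y, R^o))
    (hiter : mirror_descent_iterates A h df dhs alpha v y z)
    (halpha0 : alpha 0%N = 1%R) :
  forall k : nat, (0 < k)%N ->
    \sum_(i < k) (lambda_weight alpha k i)%:E * (f (A (y i)) + h (y i))
    - \sum_(i < k) (mu_weight alpha k i)%:E
                   * mirror_gap A f h dhs (v i) (z i) (alpha i)
    = - fenchel_conj f (- v k)%R - fenchel_conj h (adjoint A (v k)).
Proof.
move=> k k_gt0.
have step := iterate_step hf hh horacles hstanding halpha hiter halpha0.
have step_eq i := let: And3 _ _ e := step i in e.
have [F FE] : exists F : R, fenchel_conj f (- v k)%R = F%:E.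
  case: k k_gt0 => // j _.
  exact: (iterate_conj_fin hf horacles hstanding halpha hiter).
have [a [_ hv]] := iterate_h_fenchel_eq hh horacles hiter k.
(* Every summand is real, so both sums descend to [R], where the telescoping applies. *)
under eq_bigr => i _.
  by have [-> _ _] := step i; rewrite -EFinM; over.
under [X in _ - X = _]eq_bigr => i _.
  by have [_ -> _] := step i; rewrite -EFinM; over.
rewrite !sumEFin -EFinB (weighted_sum_telescope halpha0 step_eq)//.
by rewrite FE hv /= -EFinB opprD.
Qed.
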